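(* Let $\{E(t)\}_{t\ge t_0}$ be the family of equilibrium sets $E(t)=\{x\in\mathbb{R}^n: f(t,x)=0\}$. Assume that for every $R>0$, $$d_R^{\rm AW}(E(t),E(s))\le\int_s^tv_E(\tau)\,d\tau,\qquad t_0\le s\le t,$$ where $v_E\in L^1(t_0,\infty)$ is nonnegative. Assume moreover that there exists $R_0>0$ such that $E(t)\cap\{z\in\mathbb{R}^n:\|z\|\le R_0\}\ne\emptyset$ for all $t\ge t_0$. Then there exists a nonempty closed set $E_\infty\subset\mathbb{R}^n$ such that $d_R^{\rm AW}(E(t),E_\infty)\to0$ as $t\to\infty$ for every $R>0$; that is, $E(t)\to E_\infty$ in the Attouch–Wets sense.
   Context: Fix $t_0\ge 0$ and $f:[t_0,\infty)\times\mathbb{R}^n\to\mathbb{R}^n$ such that $t\mapsto f(t,x)$ is measurable for every $x$ and $x\mapsto f(t,x)$ is locally Lipschitz for a.e. $t\ge t_0$. Each $E(t)$, $t\ge t_0$, is assumed nonempty and closed. For nonempty $S$, $\mathrm{dist}(x,S)=\inf_{y\in S}\|x-y\|$. For nonempty closed sets $A,B\subset\mathbb{R}^n$ and $R>0$, $d_R^{\rm AW}(A,B):=\sup_{\|z\|\le R}|\mathrm{dist}(z,A)-\mathrm{dist}(z,B)|$. $E(t)\to E_\infty$ in the Attouch–Wets sense means $d_R^{\rm AW}(E(t),E_\infty)\to0$ as $t\to\infty$ for every $R>0$. *)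

(* Defs.v *)
From HB Require Import structures.
From mathcomp Require Import all_boot all_order all_algebra.
From mathcomp Require Import all_classical all_reals all_analysis.

Set Implicit Arguments.
Unset Strict Implicit.
Unset Printing Implicit Defensive.

Import Order.TTheory GRing.Theory Num.Theory.
Import numFieldNormedType.Exports.

Local Open Scope classical_set_scope.
Local Open Scope ring_scope.

(* MathComp's norm on 'rV[R]_n is the sup norm; the distances below are
   Euclidean.  Both norms induce the same topology, so [closed] and [nbhs] of
   the library can be used as they are. *)
Definition enorm (R : realType) (n : nat) (x : 'rV[R]_n) : R :=
  Num.sqrt (\sum_(i < n) x ord0 i ^+ 2).

Definition dist (R : realType) (n : nat) (x : 'rV[R]_n) (S : set 'rV[R]_n) : R :=
  inf [set enorm (x - y) | y in S].

(* For r > 0 and A, B nonempty the set below is nonempty and bounded, so the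
   real supremum is the genuine one. *)
Definition dAW (R : realType) (n : nat) (r : R) (A B : set 'rV[R]_n) : R :=
  sup [set `|dist z A - dist z B| | z in [set z | enorm z <= r]].

Definition attouch_wets_cvg (R : realType) (n : nat)
    (E : R -> set 'rV[R]_n) (Einf : set 'rV[R]_n) : Prop :=
  forall r : R, 0 < r -> dAW r (E t) Einf @[t --> +oo] --> (0 : R).

Definition equilibrium_set (R : realType) (n : nat)
    (f : R -> 'rV[R]_n -> 'rV[R]_n) (t : R) : set 'rV[R]_n :=
  [set x | f t x = 0].

Definition locally_lipschitz (R : realType) (n : nat)
    (g : 'rV[R]_n -> 'rV[R]_n) : Prop :=
  forall x : 'rV[R]_n, exists U L, nbhs x U /\
    forall y z, U y -> U z -> enorm (g y - g z) <= L * enorm (y - z).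

(* The line with the sigma-algebra of all Lebesgue measurable sets, i.e. the
   domain of [completed_lebesgue_measure]. *)
Definition lebesgueTypeR (R : realType) : measurableType _ :=
  caratheodory_type ((@wlength R idfun)^*)%mu.

Definition lebesgue_measurable_fun (R : realType) (n : nat)
    (D : set R) (g : R -> 'rV[R]_n) : Prop :=
  measurable_fun (D : set (lebesgueTypeR R))
    (g : lebesgueTypeR R -> g_sigma_algebraType (@open 'rV[R]_n)).

(* Main.v *)
(* The distance functions z |-> dist z (E t) are 1-Lipschitz and, the tails of
   the integral of v_E being small, uniformly Cauchy on balls; let g be their
   limit as t --> +oo and Einf its zero set.  Then dist z Einf = g z: "<=" comes
   from compactness, a cluster point of almost-projections of z on the E t being
   a zero of g at distance about g z from z, and ">=" from g being 1-Lipschitz. *)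

Require Import Defs.
From HB Require Import structures.
From mathcomp Require Import all_boot all_order all_algebra.
From mathcomp Require Import all_classical all_reals all_analysis.
From mathcomp Require Import measurable_realfun lra.

Set Implicit Arguments.
Unset Strict Implicit.
Unset Printing Implicit Defensive.

Import Order.TTheory GRing.Theory Num.Theory.
Import numFieldNormedType.Exports.

Local Open Scope classical_set_scope.
Local Open Scope ring_scope.

(** * The Euclidean norm and its comparison with the sup norm *)

Lemma enorm_ge0 (R : realType) (n : nat) (x : 'rV[R]_n) : 0 <= enorm x.
Proof. exact: sqrtr_ge0. Qed.

Lemma enorm0 (R : realType) (n : nat) : enorm (0 : 'rV[R]_n) = 0.
Proof.
rewrite /enorm big1 ?sqrtr0// => i _.
by rewrite mxE expr0n.
Qed.

Lemma enormB (R : realType) (n : nat) (x y : 'rV[R]_n) :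
  enorm (x - y) = enorm (y - x).
Proof.
rewrite /enorm; congr Num.sqrt; apply: eq_bigr => i _.
by rewrite !mxE -sqrrN opprB.
Qed.

Lemma sqr_enorm (R : realType) (n : nat) (x : 'rV[R]_n) :
  enorm x ^+ 2 = \sum_(i < n) x ord0 i ^+ 2.
Proof. by rewrite sqr_sqrtr// sumr_ge0// => i _; exact: sqr_ge0. Qed.

Lemma ler_coord_enorm (R : realType) (n : nat) (x : 'rV[R]_n) (i : 'I_n) :
  `|x ord0 i| <= enorm x.
Proof.
rewrite -(ler_pXn2r (ltn0Sn 1)) ?nnegrE ?enorm_ge0// sqr_enorm -normrX.
rewrite ger0_norm ?sqr_ge0// (bigD1 i)//= lerDl sumr_ge0// => j _.
exact: sqr_ge0.
Qed.

(** With [a], [b] the two norms, expanding the nonnegative sum of the squares of [b * x_i - a * y_i]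
    gives [2 * a * b] times the inner product at most [2 * a^2 * b^2]; divide by [a * b]. If a norm
    vanishes, so do all coordinates. *)
Lemma cauchy_schwarz (R : realType) (n : nat) (x y : 'rV[R]_n) :
  \sum_(i < n) x ord0 i * y ord0 i <= enorm x * enorm y.
Proof.
set a := enorm x; set b := enorm y.
have [a0|a0] := eqVneq a 0.
  rewrite a0 mul0r big1// => i _.
  have : `|x ord0 i| <= 0 by rewrite -a0; exact: ler_coord_enorm.
  by rewrite normr_le0 => /eqP ->; rewrite mul0r.
have [b0|b0] := eqVneq b 0.
  rewrite b0 mulr0 big1// => i _.
  have : `|y ord0 i| <= 0 by rewrite -b0; exact: ler_coord_enorm.
  by rewrite normr_le0 => /eqP ->; rewrite mulr0.
have a_gt0 : 0 < a by rewrite lt_def a0 enorm_ge0.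
have b_gt0 : 0 < b by rewrite lt_def b0 enorm_ge0.
have : 0 <= \sum_(i < n) (b * x ord0 i - a * y ord0 i) ^+ 2.
  by rewrite sumr_ge0// => i _; exact: sqr_ge0.
under eq_bigr => i _.
  rewrite (_ : _ ^+ 2 = b ^+ 2 * x ord0 i ^+ 2 + a ^+ 2 * y ord0 i ^+ 2 -
    a * b * 2 * (x ord0 i * y ord0 i)); last by lra.
  over.
rewrite sumrB big_split/= -!mulr_sumr -!sqr_enorm -/a -/b => h.
rewrite -(ler_pM2l (mulr_gt0 a_gt0 b_gt0)); lra.
Qed.

Lemma ler_enormD (R : realType) (n : nat) (x y : 'rV[R]_n) :
  enorm (x + y) <= enorm x + enorm y.
Proof.
rewrite -(ler_pXn2r (ltn0Sn 1)) ?nnegrE ?addr_ge0 ?enorm_ge0//.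
rewrite sqr_enorm sqrrD !sqr_enorm.
under eq_bigr do rewrite mxE sqrrD.
rewrite !big_split/= lerD2r lerD2l.
by rewrite mulr2n lerD// cauchy_schwarz.
Qed.

Lemma ler_enormB (R : realType) (n : nat) (x y z : 'rV[R]_n) :
  enorm (x - z) <= enorm (x - y) + enorm (y - z).
Proof. by rewrite -[x - z](subrKA y) ler_enormD. Qed.

(** The bridge from the sup-norm topology: with [d = e / (n + 1)], a sup-norm ball of radius [d] has
    squared Euclidean distances at most [n * d^2 <= (n * d)^2 < e^2]. Dividing by [n + 1] also
    covers [n = 0]. *)
Lemma nbhs_enorm (R : realType) (n : nat) (x : 'rV[R]_n) (e : R) :
  0 < e -> \forall y \near x, enorm (x - y) < e.
Proof.
move=> e0; have d0 : 0 < e / n.+1%:R by rewrite divr_gt0.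
apply: filterS (nbhsx_ballx x _ d0) => y [_ xy].
have de : (e / n.+1%:R) *+ n < e.
  by rewrite -mulr_natr -mulrA gtr_pMr// mulrC ltr_pdivrMr// mul1r ltr_nat.
apply: le_lt_trans de.
have d2 : 0 <= e / n.+1%:R *+ n by rewrite mulrn_wge0// ltW.
rewrite -(ler_pXn2r (ltn0Sn 1)) ?nnegrE ?enorm_ge0// sqr_enorm.
have dn : (e / n.+1%:R) ^+ 2 *+ n <= (e / n.+1%:R *+ n) ^+ 2.
  rewrite exprMn_n ler_wpMn2l ?sqr_ge0//.
  by case: (n) => // m; rewrite leq_pmulr.
apply: le_trans dn; rewrite -[X in _ *+ X](card_ord n) -sumr_const.
apply: ler_sum => i _; rewrite !mxE -(real_normK (num_real _)).
by rewrite ler_pXn2r ?nnegrE// ltW//; exact: xy.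
Qed.

(** * Distance functions and bounds on [dAW] *)

Lemma ler_dist (R : realType) (n : nat) (S : set 'rV[R]_n) (x y : 'rV[R]_n) :
  S y -> dist x S <= enorm (x - y).
Proof.
move=> Sy; apply: ge_inf; last by exists y.
by exists 0 => _ [z _ <-]; exact: enorm_ge0.
Qed.

Lemma dist_ge (R : realType) (n : nat) (S : set 'rV[R]_n) (x : 'rV[R]_n)
    (c : R) :
  S !=set0 -> (forall y, S y -> c <= enorm (x - y)) -> c <= dist x S.
Proof.
move=> [s Ss] h; apply: lb_le_inf; first by exists (enorm (x - s)), s.
by move=> _ [y Sy <-]; exact: h.
Qed.

Lemma dist_ge0 (R : realType) (n : nat) (S : set 'rV[R]_n) (x : 'rV[R]_n) :
  S !=set0 -> 0 <= dist x S.
Proof. by move=> S0; apply: dist_ge => // y _; exact: enorm_ge0. Qed.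

Lemma dist_adherent (R : realType) (n : nat) (S : set 'rV[R]_n)
    (x : 'rV[R]_n) (e : R) :
  S !=set0 -> 0 < e -> exists2 y, S y & enorm (x - y) < dist x S + e.
Proof.
move=> [s Ss] e0; have [] := @inf_adherent _ [set enorm (x - y) | y in S] _ e0.
  split; first by exists (enorm (x - s)), s.
  by exists 0 => _ [z _ <-]; exact: enorm_ge0.
by move=> _ [y Sy <-] h; exists y.
Qed.

Lemma dist_lipschitz (R : realType) (n : nat) (S : set 'rV[R]_n)
    (x y : 'rV[R]_n) :
  S !=set0 -> dist x S <= enorm (x - y) + dist y S.
Proof.
move=> S0; rewrite -lerBlDl; apply: dist_ge => // z Sz.
by rewrite lerBlDl (le_trans (ler_dist x Sz))// ler_enormB.
Qed.

(** The supremum is over a bounded set: comparison with the origin gives [dist w A <= r + dist 0 A]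
    on the ball, and likewise for [B]. *)
Lemma ler_dAW (R : realType) (n : nat) (r : R) (A B : set 'rV[R]_n)
    (z : 'rV[R]_n) :
  A !=set0 -> B !=set0 -> enorm z <= r ->
  `|dist z A - dist z B| <= dAW r A B.
Proof.
move=> A0 B0 zr; apply: ub_le_sup; last by exists z.
exists (r + dist 0 A + (r + dist 0 B)) => _ [w /= wr <-].
have hA := dist_lipschitz w 0 A0; have hB := dist_lipschitz w 0 B0.
rewrite subr0 in hA hB.
have := dist_ge0 w A0; have := dist_ge0 w B0.
have := dist_ge0 0 A0; have := dist_ge0 0 B0.
by rewrite ler_norml; move: hA hB wr; lra.
Qed.

Lemma dAW_le (R : realType) (n : nat) (r e : R) (A B : set 'rV[R]_n) :
  0 <= r ->
  (forall z, enorm z <= r -> `|dist z A - dist z B| <= e) -> dAW r A B <= e.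
Proof.
move=> r0 h; apply: ge_sup; last by move=> _ [z zr <-]; exact: h.
by exists `|dist 0 A - dist 0 B|, 0 => //=; rewrite enorm0.
Qed.

Lemma dAW_ge0 (R : realType) (n : nat) (r : R) (A B : set 'rV[R]_n) :
  0 <= r -> A !=set0 -> B !=set0 -> 0 <= dAW r A B.
Proof.
move=> r0 A0 B0; apply: le_trans (ler_dAW A0 B0 (_ : enorm 0 <= r)) => //.
by rewrite enorm0.
Qed.

(** * Small tails of integrable functions *)

(** Dominated convergence, with [|v|] as dominating function, sends the integrals of [|v|] over [D]
    and [F k] to 0. They bound the integral over every [A] inside, so [k] does not depend on [A]. *)
Lemma integrable_vanishing (d : measure_display) (T : measurableType d)
    (R : realType) (mu : {measure set T -> \bar R}) (D : set T)
    (F : nat -> set T) (v : T -> R) (e : R) :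
  measurable D -> (forall k, measurable (F k)) ->
  (forall x, D x -> \forall k \near \oo, ~ F k x) ->
  mu.-integrable D (EFin \o v) -> 0 < e ->
  \forall k \near \oo, forall A, measurable A -> A `<=` D `&` F k ->
    \int[mu]_(x in A) v x <= e.
Proof.
move=> mD mF Fx iv e0.
have mv : measurable_fun D (EFin \o v) by case/integrableP : iv.
have iV : mu.-integrable D (abse \o (EFin \o v)) by exact: integrable_abse.
have mV : measurable_fun D (abse \o (EFin \o v)) by case/integrableP : iV.
pose g k := (abse \o (EFin \o v)) \_ (F k).
have : (\int[mu]_(x in D) g k x @[k --> \oo] --> \int[mu]_(x in D) 0)%E.
  apply: (@dominated_cvg _ T R mu _ _ g _ (abse \o (EFin \o v))) => //.
  - move=> k; apply/(measurable_restrict _ (mF k) mD).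
    by apply: measurable_funS mV => //; exact: subIsetl.
  - move=> x Dx; apply: cvg_near_cst; apply: filterS (Fx x Dx) => k Fkx.
    by rewrite /g patchE memNset.
  - move=> k x _; rewrite /g patchE; case: ifPn => _ /=.
      by rewrite normr_id.
    by rewrite normr0 lee_fin.
rewrite integral0 => /fine_cvgP[fing] /cvgr_le/(_ e e0) ge.
near=> k => A mA ADF.
have DF : A `<=` D by move=> x /ADF[].
have ivA : mu.-integrable A (EFin \o v) by exact: integrableS iv.
have fgk : (\int[mu]_(x in D) g k x)%E \is a fin_num by near: k.
apply: le_trans (_ : fine (\int[mu]_(x in D) g k x)%E <= e); last by near: k.
apply: le_trans (ler_norm _) _; apply: le_trans (le_normr_Rintegral mA ivA) _.
rewrite /Rintegral fine_le//.
  by apply: integrable_fin_num => //; exact: integrable_norm.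
rewrite -integral_mkcondr; apply: ge0_subset_integral => //.
  exact: measurableI.
by apply: measurable_funS mV => //; exact: subIsetl.
Unshelve. all: by end_near. Qed.

Lemma integrable_tail (R : realType) (a : R) (v : R -> R) (e : R) :
  (@completed_lebesgue_measure R).-integrable `]a, +oo[ (EFin \o v) -> 0 < e ->
  exists2 T, a < T & forall s t, T <= s -> s <= t ->
    \int[@completed_lebesgue_measure R]_(tau in `[s, t]) v tau <= e.
Proof.
move=> iv e0.
have mitv (i : interval R) : measurable ([set` i] : set (lebesgueTypeR R)).
  by apply: sub_caratheodory; exact: measurable_itv.
have [|k _ /(_ k (leqnn k)) hk] := integrable_vanishing (mitv _)
    (fun k : nat => mitv `]k%:R, +oo[) _ iv e0.
  move=> x _; near=> k; rewrite /= in_itv/= andbT => kx.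
  suff : x <= k%:R by rewrite leNgt kx.
  by near: k; exact: nbhs_infty_ger.
(* The margins of 1 put the closed interval from [s] to [t] inside both half-lines, which are open
   at [a] and [k]. *)
exists (Num.max (a + 1) (k%:R + 1)); first by rewrite lt_max ltrDl ltr01.
move=> s t; rewrite ge_max => /andP[as_ ks] st; apply: hk; first exact: mitv.
by move=> x /=; rewrite !in_itv/= !andbT => /andP[sx _]; split; lra.
Unshelve. all: by end_near. Qed.

(** * Completeness for Attouch-Wets convergence *)

(** Isolates the metric argument: the integral bound will enter only through this Cauchy
    condition. *)
Lemma attouch_wets_cauchy_cvg (R : realType) (n : nat) (E : R -> set 'rV[R]_n)
    (t0 : R) :
  (forall t, t0 <= t -> E t !=set0) ->
  (forall r e, 0 < r -> 0 < e -> exists2 T, t0 <= T &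
    forall s t, T <= s -> s <= t -> dAW r (E t) (E s) <= e) ->
  exists Einf, [/\ Einf !=set0, closed Einf & attouch_wets_cvg E Einf].
Proof.
move=> E0 Ecauchy.
pose d z t := dist z (E t).
pose g z := lim (d z t @[t --> +oo]).
have d_cauchy r e : 0 < r -> 0 < e -> exists2 T, t0 <= T &
    forall z s t, enorm z <= r -> T <= s -> s <= t -> `|d z t - d z s| <= e.
  move=> r0 e0; have [T t0T hT] := Ecauchy r e r0 e0.
  exists T => // z s t zr Ts st; apply: le_trans (hT s t Ts st).
  by apply: ler_dAW => //; apply: E0; lra.
have enorm1 (z : 'rV[R]_n) : enorm z <= enorm z + 1 by rewrite lerDl.
have enorm1_gt0 (z : 'rV[R]_n) : 0 < enorm z + 1 by rewrite ltr_wpDl ?enorm_ge0.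
have d_cvg z : d z t @[t --> +oo] --> g z.
  apply: (@cauchy_cvg R); apply: cauchy_exP => e e0.
  have [T _ hT] := d_cauchy _ _ (enorm1_gt0 z) (divr_gt0 e0 (ltr0n R 2)).
  exists (d z T); suff : \forall t \near +oo, ball (d z T) e (d z t) by [].
  apply: filterS (nbhs_pinfty_ge (num_real T)) => t Tt; rewrite /ball/= distrC.
  by apply: (@le_lt_trans _ _ (e / 2)); [exact: hT|lra].
(* Letting [t] tend to infinity with [s] fixed in [d_cauchy] makes the convergence to [g] uniform on
   balls. *)
have g_approx r e : 0 < r -> 0 < e -> exists2 T, t0 <= T &
    forall z s, enorm z <= r -> T <= s -> `|d z s - g z| <= e.
  move=> r0 e0; have [T t0T hT] := d_cauchy r e r0 e0.
  exists T => // z s zr Ts; rewrite distrC.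
  have hc : `|d z t - d z s| @[t --> +oo] --> `|g z - d z s|.
    by apply: cvg_norm; apply: cvgB => //; exact: cvg_cst.
  apply: (cvgr_to_le hc).
  by apply: filterS (nbhs_pinfty_ge (num_real s)) => t st; exact: hT.
have near_t0 : \forall t \near +oo, t0 <= t by exact: nbhs_pinfty_ge (num_real _).
have g_ge0 z : 0 <= g z.
  apply: (cvgr_to_ge (d_cvg z)).
  by apply: filterS near_t0 => t t0t; exact: dist_ge0 (E0 t t0t).
have g_lip x y : g x <= enorm (x - y) + g y.
  have hy : enorm (x - y) + d y t @[t --> +oo] --> enorm (x - y) + g y.
    by apply: cvgD => //; exact: cvg_cst.
  apply: (ler_cvg_to (d_cvg x) hy).
  by apply: filterS near_t0 => t t0t; exact: dist_lipschitz (E0 t t0t).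
pose Einf := [set z | g z = 0].
have Einf_near z e : 0 < e -> exists2 y, Einf y & enorm (z - y) <= g z + e.
  (* Take a cluster point of near-projections [Y t] of [z] on [E t]: uniform
     convergence on balls and [d (Y t) t = 0] force [g] to vanish there. *)
  move=> e0.
  (* The value 0 before [t0] is arbitrary; only large [t] matter. *)
  have /choice[Y hY] t : exists y, t0 <= t ->
      E t y /\ enorm (z - y) < d z t + e / 2.
    have [t0t|] := leP t0 t; last by exists 0.
    have [y Ey hy] := dist_adherent z (E0 t t0t) (divr_gt0 e0 (ltr0n R 2)).
    by exists y.
  pose A c := [set y | enorm (z - y) <= g z + e /\ g y <= c].
  (* By the triangle inequality, [M] bounds the norm of every point of [A c]. *)
  pose M := enorm z + (g z + e).
  have A_near c : 0 < c -> \forall t \near +oo, A c (Y t).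
    move=> c0; have M_gt0 : 0 < M by rewrite ltr_wpDl ?enorm_ge0// ltr_wpDl.
    have [T t0T hT] := g_approx M c M_gt0 c0.
    have dz_near : \forall t \near +oo, d z t <= g z + e / 2.
      by apply: (cvgr_le _ (d_cvg z)); rewrite ltrDl divr_gt0.
    have T_near := nbhs_pinfty_ge (num_real T).
    near=> t; have Tt : T <= t by near: t.
    have [Et zY] := hY t (le_trans t0T Tt).
    have dz : d z t <= g z + e / 2 by near: t.
    have zYe : enorm (z - Y t) <= g z + e by lra.
    split=> //.
    have YM : enorm (Y t) <= M.
      rewrite -[Y t]subr0 (le_trans (ler_enormB _ z _))// subr0 addrC lerD2l.
      by rewrite enormB.
    (* [Y t] lies in the ball where the approximation is uniform, so [g (Y t)] is at most
       [d (Y t) t + c]. *)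
    have := hT _ _ YM Tt; rewrite ler_norml => /andP[+ _].
    have : d (Y t) t <= 0.
      by apply: le_trans (ler_dist _ Et) _; rewrite subrr enorm0.
    lra.
  (* [Y t] eventually stays in the compact cube of half-side [M], since coordinates are bounded by
     the Euclidean norm; [p] is a cluster point. *)
  have [|p [_ clp]] := @rV_compact R n (fun=> `[- M, M]%classic)
      (fun=> @segment_compact R _ _) (Y @ +oo) _.
    suff : \forall t \near +oo, forall i, `[- M, M]%classic (Y t ord0 i) by [].
    near=> t => i.
    have [zY _] : A 1 (Y t) by near: t; exact: A_near.
    suff : `|Y t ord0 i| <= M by rewrite ler_norml => /= ?; rewrite in_itv.
    apply: le_trans (ler_coord_enorm _ _) _.
    rewrite -[Y t]subr0 (le_trans (ler_enormB _ z _))// subr0 addrC lerD2l.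
    by rewrite enormB.
  have p_approx c : 0 < c -> exists2 y, A c y & enorm (p - y) < c.
    move=> c0; have [y [Ay py]] := clp _ _ (A_near c c0) (nbhs_enorm p c0).
    by exists y.
  exists p; last first.
    apply/ler_addgt0Pr => c c0; have [y [zy _] py] := p_approx c c0.
    by have := ler_enormB z y p; rewrite (enormB y); lra.
  (* A point [y] of [A (c / 2)] within [c / 2] of [p] gives [g p <= c], because [g] is
     1-Lipschitz. *)
  apply/eqP; rewrite eq_le g_ge0 andbT; apply/ler_addgt0Pr => c c0.
  have [y [_ gy] py] := p_approx _ (divr_gt0 c0 (ltr0n R 2)).
  by have := g_lip p y; lra.
have Einf0 : Einf !=set0 by have [y] := Einf_near 0 1 ltr01; exists y.
have Einf_dist z : dist z Einf = g z.
  apply/eqP; rewrite eq_le; apply/andP; split.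
    apply/ler_addgt0Pr => e e0; have [y Ey zy] := Einf_near z e e0.
    exact: le_trans (ler_dist z Ey) zy.
  apply: dist_ge => // y Ey; have := g_lip z y.
  by rewrite [g y]Ey addr0.
exists Einf; split => //.
  (* At a point of the closure, zeros of [g] arbitrarily near force [g x <= e] for every positive
     [e]. *)
  move=> x cx; apply/eqP; rewrite eq_le g_ge0 andbT.
  apply/ler_addgt0Pr => e e0; rewrite add0r.
  have [y [Ey /ltW xy]] := cx _ (nbhs_enorm x e0).
  by apply: le_trans (g_lip x y) _; rewrite [g y]Ey addr0.
move=> r r0; apply/cvgrPdist_le => e e0.
have [T t0T hT] := g_approx r e r0 e0.
have T_near := nbhs_pinfty_ge (num_real T).
near=> t; have Tt : T <= t by near: t.
rewrite sub0r normrN ger0_norm; last first.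
  by apply: dAW_ge0 => //; [exact: ltW|apply: E0; lra].
apply: dAW_le => [|z zr]; first exact: ltW.
by rewrite Einf_dist; exact: hT.
Unshelve. all: by end_near. Qed.

Theorem proposition5p7 (R : realType) (n : nat) (t0 : R)
  (f : R -> 'rV[R]_n -> 'rV[R]_n) (v_E : R -> R)
  (ht0 : 0 <= t0)
  (hf_meas : forall x, lebesgue_measurable_fun `[t0, +oo[ (f^~ x))
  (hf_lip : {ae @completed_lebesgue_measure R, forall t,
    t0 <= t -> locally_lipschitz (f t)})
  (hE : forall t, t0 <= t ->
    equilibrium_set f t !=set0 /\ closed (equilibrium_set f t))
  (hv_int : (@completed_lebesgue_measure R).-integrable
    `]t0, +oo[ (EFin \o v_E))
  (hv_ge0 : {ae @completed_lebesgue_measure R, forall t,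
    t0 < t -> 0 <= v_E t})
  (hAW : forall r, 0 < r -> forall s t, t0 <= s -> s <= t ->
    dAW r (equilibrium_set f t) (equilibrium_set f s) <=
    \int[@completed_lebesgue_measure R]_(tau in `[s, t]) v_E tau)
  (hR0 : exists2 R0 : R, 0 < R0 & forall t, t0 <= t ->
    equilibrium_set f t `&` [set z | enorm z <= R0] !=set0) :
  exists Einf : set 'rV[R]_n,
    [/\ Einf !=set0, closed Einf &
        attouch_wets_cvg (equilibrium_set f) Einf].
Proof.
apply: (@attouch_wets_cauchy_cvg _ _ _ t0) => [t /hE[]//|r e r0 e0].
(* [T] depends on [e] alone, so one threshold serves every radius [r]. *)
have [T t0T hT] := integrable_tail hv_int e0.
exists T => [|s t Ts st]; first exact: ltW.
by apply: le_trans (hAW r r0 s t _ st) (hT s t Ts st); lra.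
Qed.
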